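(* Let $X,Y$ be real Hilbert spaces, let $A,V:X\to Y$ be bounded linear operators, and let $G:X\to\mathbb{R}\cup\{\infty\}$ and $F^*:Y\to\mathbb{R}\cup\{\infty\}$ be proper, lower semicontinuous functions that are $\gamma_G$-strongly convex and $\gamma_{F^*}$-strongly convex, respectively, with $$\gamma_G\,\gamma_{F^*} > \tfrac14\|A-V\|^2 .$$ Then there exists a unique $\hat u=(\hat x,\hat y)\in X\times Y$ such that $$0\in \partial G(\hat x)+V^*\hat y\quad\text{and}\quad 0\in \partial F^*(\hat y)-A\hat x .$$
   Context: $\partial$ denotes the convex subdifferential, $V^*$ the Hilbert-space adjoint of $V$, and $\|A-V\|$ the operator norm. A function $G$ is $\gamma$-strongly convex ($\gamma>0$) if $G-\tfrac{\gamma}{2}\|\cdot\|^2$ is convex. The function $F^*$ is simply a proper, convex, lower semicontinuous function on $Y$ (in applications the Fenchel conjugate of some $F$). In general $V\neq A$. *)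

(* Defs.v *)
From HB Require Import structures.
From mathcomp Require Import all_boot all_order all_algebra.
From mathcomp Require Import all_classical all_reals all_analysis.

Set Implicit Arguments.
Unset Strict Implicit.
Unset Printing Implicit Defensive.

Import Order.TTheory GRing.Theory Num.Theory.
Import numFieldNormedType.Exports.

Local Open Scope classical_set_scope.
Local Open Scope ring_scope.

HB.mixin Record isHilbert (R : realType) H of CompleteNormedModule R H := {
  inner : {dot H for (@idfun R)} ;
  inner_normE : forall x : H, inner x x = `|x| ^+ 2
}.

#[short(type="hilbertType")]
HB.structure Definition Hilbert (R : realType) :=
  {H of CompleteNormedModule R H & isHilbert R H}.

Section Operators.
Context {R : realType} {X Y : hilbertType R}.

Definition op_norm (T : X -> Y) : R :=
  sup [set `|T x| | x in [set x : X | `|x| <= 1]].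

(* The default value 0 is never reached when T is linear and bounded (Riesz);
   the vector z is unique since the inner product is definite. *)
Definition adjoint (T : X -> Y) (y : Y) : X :=
  xget 0 [set z : X | forall x : X, inner (T x) y = inner x z].

End Operators.

Section ConvexAnalysis.
Context {R : realType} {H : hilbertType R}.
Local Open Scope ereal_scope.

Definition eproper (f : H -> \bar R) : Prop :=
  (forall x, -oo < f x) /\ exists x, f x < +oo.

(* For f without the value -oo this is ordinary convexity: in \bar R,
   0 * +oo = 0, so the cases t = 0 and t = 1 hold trivially. *)
Definition econvex (f : H -> \bar R) : Prop :=
  forall (x y : H) (t : R), (0 <= t <= 1)%R ->
    f (t *: x + (1 - t) *: y)%R <= t%:E * f x + (1 - t)%:E * f y.

Definition strongly_convex (gamma : R) (f : H -> \bar R) : Prop :=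
  econvex (fun x => f x - (gamma / 2 * `|x| ^+ 2)%:E).

(* For proper f this set is empty whenever f x = +oo. *)
Definition subdiff (f : H -> \bar R) (x : H) : set H :=
  [set p : H | forall z : H, f x + (inner p (z - x)%R)%:E <= f z].

End ConvexAnalysis.

(* Main.v *)
(* A strongly convex, proper, lower semicontinuous function [f] has a minimizer,
   so for all [p] and [s >= 0] there is [x] with p - s x in df(x); moreover its
   subgradients [q] at [x] satisfy the stronger inequality
   f z >= f x + <q, z - x> + (gamma / 2) |z - x|^2. Minimizing |z|^2 / 2 - l z
   gives the Riesz representation theorem, hence the adjoint.
   Let [eta x] be the point with A x in dF*(eta x); it is Lipschitz in [x].
   Completing the square in <(A - V) dx, dy> shows that
   x |-> V* (eta x) + gammaG x is strongly monotone, precisely because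
   4 gammaG gammaF > |A - V|^2. So for large [s] the map T given by
   s x - V* (eta x) - s (T x) in dG(T x) is a contraction of [X], and a fixed
   point [x] yields the solution (x, eta x). The same square completion gives
   uniqueness. *)
Require Import Defs.
From mathcomp Require Import all_boot all_order all_algebra.
From mathcomp Require Import all_classical all_reals all_analysis.
From mathcomp Require Import ring lra.

Import Order.TTheory GRing.Theory Num.Theory.
Import numFieldNormedType.Exports.

Local Open Scope classical_set_scope.
Local Open Scope ring_scope.

(** * Inner product identities and Cauchy-Schwarz *)

Section InnerProduct.
Context {R : realType} {H : hilbertType R}.
Implicit Types x y z : H.

Lemma innerC x y : inner x y = inner y x.
Proof. by rewrite hermC /= expr0 mul1r. Qed.

Lemma innerZl a x y : inner (a *: x) y = a * inner x y.
Proof. exact: linearZl_LR. Qed.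

Lemma innerZr a x y : inner x (a *: y) = a * inner x y.
Proof. exact: linearZr_LR. Qed.

Lemma innerNl x y : inner (- x) y = - inner x y.
Proof. exact: linearNl. Qed.

Lemma innerDr x y z : inner x (y + z) = inner x y + inner x z.
Proof. exact: linearDr. Qed.

Lemma innerBl x y z : inner (x - y) z = inner x z - inner y z.
Proof. exact: linearBl. Qed.

Lemma innerBr x y z : inner x (y - z) = inner x y - inner x z.
Proof. exact: linearBr. Qed.

Lemma normD_sqr x y : `|x + y| ^+ 2 = `|x| ^+ 2 + 2 * inner x y + `|y| ^+ 2.
Proof.
rewrite -!inner_normE linearDl /= !linearDr /= (innerC y x); ring.
Qed.

Lemma normB_sqr x y : `|x - y| ^+ 2 = `|x| ^+ 2 - 2 * inner x y + `|y| ^+ 2.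
Proof. rewrite normD_sqr normrN linearNr; ring. Qed.

Lemma normZ_sqr a x : `|a *: x| ^+ 2 = a ^+ 2 * `|x| ^+ 2.
Proof. by rewrite normrZ exprMn real_normK ?num_real. Qed.

(** The last term is the defect of the squared norm from affinity, the source of the quadratic term
    in strong convexity. *)
Lemma norm_conv_sqr x y t :
  `|t *: x + (1 - t) *: y| ^+ 2 =
  t * `|x| ^+ 2 + (1 - t) * `|y| ^+ 2 - t * (1 - t) * `|x - y| ^+ 2.
Proof.
rewrite normB_sqr normD_sqr !normZ_sqr innerZl innerZr; ring.
Qed.

Lemma inner_le_norm x y : inner x y <= `|x| * `|y|.
Proof.
have [->|x0] := eqVneq x 0; first by rewrite linear0l normr0 mul0r.
have [->|y0] := eqVneq y 0; first by rewrite linear0r normr0 mulr0.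
have pos : 0 < `|x| * `|y| by rewrite mulr_gt0 ?normr_gt0.
have : 0 <= `| `|y| *: x - `|x| *: y| ^+ 2 by exact: exprn_ge0.
rewrite normB_sqr !normZ_sqr innerZl innerZr.
have -> : `|y| ^+ 2 * `|x| ^+ 2 - 2 * (`|y| * (`|x| * inner x y))
    + `|x| ^+ 2 * `|y| ^+ 2 = 2 * (`|x| * `|y|) * (`|x| * `|y| - inner x y).
  by ring.
by rewrite (pmulr_rge0 _ (mulr_gt0 (ltr0Sn R 1) pos)) subr_ge0.
Qed.

Lemma inner_polarization x y :
  inner x y = 2^-1 * (`|x + y| ^+ 2 - `|x| ^+ 2 - `|y| ^+ 2).
Proof. rewrite normD_sqr; lra. Qed.

End InnerProduct.

(** * Strong convexity and subgradients on a domain *)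

Definition strongly_convex_on {R : realType} {H : hilbertType R}
    (c : R) (D : set H) (g : H -> R) : Prop :=
  forall (x y : H) (t : R), D x -> D y -> 0 <= t <= 1 ->
    D (t *: x + (1 - t) *: y) /\
    g (t *: x + (1 - t) *: y) + c * (t * (1 - t)) * `|x - y| ^+ 2
      <= t * g x + (1 - t) * g y.

(* Lower semicontinuity of the extension of [g] by [+oo] outside [D]. *)
Definition lsc_on {R : realType} {H : hilbertType R}
    (D : set H) (g : H -> R) : Prop :=
  forall (x : H) (a : R), (D x -> a < g x) ->
    \forall y \near x, D y -> a < g y.

(** [c] is half the usual modulus. With the quadratic term built in, strong monotonicity is a mere
    sum of two inequalities. *)
Definition strong_subgradient {R : realType} {H : hilbertType R}
    (c : R) (D : set H) (g : H -> R) (x q : H) : Prop :=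
  D x /\ forall z, D z -> g x + inner q (z - x) + c * `|z - x| ^+ 2 <= g z.

Lemma ge0_of_perturbation {R : realType} (a b : R) :
  (forall t, 0 < t <= 1 -> 0 <= a + t * b) -> 0 <= a.
Proof.
move=> ab; apply/ler_addgt0Pr => e e0.
have b1 : 0 < `|b| + 1 by rewrite ltr_pwDr.
pose t := Num.min 1 (e / (`|b| + 1)).
have t0 : 0 < t by rewrite lt_min ltr01 divr_gt0.
have t1 : t <= 1 by rewrite ge_min lexx.
have te : t * (`|b| + 1) <= e by rewrite -ler_pdivlMr // ge_min lexx orbT.
have := ab t; rewrite t0 t1 => /(_ isT) /le_trans; apply; rewrite lerD2l.
by rewrite (le_trans _ te)// ler_pM2l// (le_trans (ler_norm b))// lerDl.
Qed.

Section StrongConvexity.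
Context {R : realType} {H : hilbertType R}.
Context (c : R) (D : set H) (g : H -> R).
Context (gc : strongly_convex_on c D g).

(* Test the inequality at points tending to [x] along the segment to [z]:
   the quadratic error is of second order and the modulus [c] appears. *)
Lemma strong_subgradient_of_error (s : R) (x q : H) : D x ->
  (forall z, D z -> g x + inner q (z - x) <= g z + s * `|z - x| ^+ 2) ->
  strong_subgradient c D g x q.
Proof.
move=> Dx xq; split => // z Dz.
rewrite -subr_ge0; apply: (@ge0_of_perturbation _ _ ((c + s) * `|z - x| ^+ 2)).
move=> t /andP[t0 t1].
have [|Dt gt] := gc z x t Dz Dx; first by rewrite (ltW t0).
have tx : t *: z + (1 - t) *: x - x = t *: (z - x).
  by rewrite scalerBl scale1r scalerBr -addrA (addrAC x) subrr add0r.
have := xq _ Dt; rewrite tx innerZr normZ_sqr => h.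
rewrite -(pmulr_rge0 _ t0); nra.
Qed.

Lemma strong_subgradient_mono (x x' q q' : H) :
  strong_subgradient c D g x q -> strong_subgradient c D g x' q' ->
  2 * c * `|x - x'| ^+ 2 <= inner (q - q') (x - x').
Proof.
move=> [Dx xq] [Dx' xq']; have := xq _ Dx'; have := xq' _ Dx.
rewrite (distrC x' x) -(opprB x x') linearNr innerBl; lra.
Qed.

End StrongConvexity.

Arguments strong_subgradient_of_error {R H c D g} gc {s x q}.
Arguments strong_subgradient_mono {R H c D g x x' q q'}.

(** * Existence of minimizers *)

Section Minimization.
Context {R : realType} {H : hilbertType R}.
Context {c : R} {D : set H} {g : H -> R}.
Context (c0 : 0 < c) (gc : strongly_convex_on c D g).
Context (D0 : D !=set0) (gl : lsc_on D g).

(* Near a point [x0] of [D], [g] is bounded below by lower semicontinuity;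
   strong convexity along rays from [x0] propagates this to all of [D]. *)
Lemma strongly_convex_lbound : exists m, forall z, D z -> m <= g z.
Proof.
have [x0 Dx0] := D0.
have [|d /= d0 dP] := iffLR (nbhs_ballP _ _) (gl x0 (g x0 - 1) _).
  by move=> _; rewrite ltrBlDr ltrDl.
pose e := d / 2; have e0 : 0 < e by rewrite divr_gt0.
(* The inverse is minus the minimum over [r] of [c / 2 * r ^+ 2 - r / e], the growth found at
   distance [r] from [x0]. *)
exists (g x0 - 1 - (2 * c * e ^+ 2)^-1) => z Dz.
have k0 : 0 < (2 * c * e ^+ 2)^-1 by rewrite invr_gt0 !mulr_gt0.
have [zd|dz] := ltP `|x0 - z| d.
  have := dP z; rewrite -ball_normE => /(_ zd Dz); lra.
set r := `|x0 - z| in dz.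
have r0 : 0 < r by exact: lt_le_trans dz.
(* The point at parameter [t] lies at distance [e] from [x0], inside the ball; [r >= 2 * e] gives
   [t <= 2^-1]. *)
pose t := e / r; have t0 : 0 < t by rewrite divr_gt0.
have tr : t * r = e by rewrite /t divfK // gt_eqF.
have t2 : t <= 2^-1 by rewrite /t ler_pdivrMr // /e mulrC ler_pM2l// invr_gt0.
have [|Dt gt] := gc z x0 t Dz Dx0; first by rewrite ltW //=; lra.
have := dP (t *: z + (1 - t) *: x0); rewrite -ball_normE.
have xt : x0 - (t *: z + (1 - t) *: x0) = t *: (x0 - z).
  by rewrite scalerBl scale1r scalerBr opprD opprB addrA addrC addrA subrK.
rewrite /= xt normrZ gtr0_norm // -/r tr => /(_ _ Dt) ht.
have {}ht : g x0 - 1 < g (t *: z + (1 - t) *: x0).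
  by apply: ht; rewrite /e ltr_pdivrMr // ltr_pMr // ltr1n.
move: gt; rewrite distrC -/r => gt.
have rt : t^-1 = r / e by rewrite /t invf_div.
have h1 : g x0 - r / e + c * (1 - t) * r ^+ 2 <= g z.
  rewrite -rt -(ler_pM2l t0) mulrDr mulrBr mulfV ?gt_eqF //; lra.
have h2 : 0 <= (c * r - e^-1) ^+ 2 by exact: sqr_ge0.
have h3 : c / 2 * r ^+ 2 <= c * (1 - t) * r ^+ 2.
  by rewrite ler_pM2r ?exprn_gt0 // ler_pM2l //; lra.
have h4 : (2 * c)^-1 * (c * r - e^-1) ^+ 2 =
    c / 2 * r ^+ 2 - r / e + (2 * c * e ^+ 2)^-1.
  by field; rewrite !gt_eqF.
have h5 : 0 <= (2 * c)^-1 * (c * r - e^-1) ^+ 2.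
  by rewrite mulr_ge0 // invr_ge0 mulr_ge0 // ltW.
lra.
Qed.

(** Strong convexity at midpoints makes a minimizing sequence Cauchy; lower semicontinuity puts its
    limit in [D] and attains the infimum there. *)
Lemma strongly_convex_min : exists2 x, D x & forall z, D z -> g x <= g z.
Proof.
have [b bP] := strongly_convex_lbound.
have hinf : has_inf (g @` D).
  split; first by have [z Dz] := D0; exists (g z), z.
  by exists b => _ [z Dz <-]; exact: bP.
set m := inf (g @` D).
have mP z : D z -> m <= g z by move=> Dz; apply: ge_inf; [case: hinf|exists z].
have /choice[u uP] : forall n : nat, exists z, D z /\ g z < m + n.+1%:R^-1.
  move=> n; have [|_ [z Dz <-] zm] := @inf_adherent _ (g @` D) n.+1%:R^-1 _ hinf.
    by rewrite invr_gt0.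
  by exists z.
have invn e : 0 < e -> \forall n \near \oo, (n.+1%:R^-1 : R) < e.
  by move=> e0; exact: (near_infty_natSinv_lt (PosNum e0)).
have mid x y e : D x -> D y -> g x < m + e -> g y < m + e ->
    `|x - y| ^+ 2 < 4 * e / c.
  move=> Dx Dy gx gy; have [|Dm] := gc x y 2^-1 Dx Dy; first by lra.
  have := mP _ Dm; rewrite ltr_pdivlMr //; lra.
have ucvg : cvg (u @ \oo).
  apply: cauchy_cvg; apply: cauchy_exP => e e0.
  have d0 : 0 < c * e ^+ 2 / 4 by rewrite divr_gt0 // mulr_gt0 // exprn_gt0.
  have [N _ NP] := invn _ d0; exists (u N), N => // n /= Nn.
  have [DN uN] := uP N; have [Dn un] := uP n.
  have gN k : (N <= k)%N -> g (u k) < m + c * e ^+ 2 / 4.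
    by move=> Nk; rewrite (lt_trans (uP k).2) // ltrD2l NP.
  rewrite -ball_normE /= -(ltr_pXn2r (ltn0Sn 1)) ?nnegrE ?normr_ge0 ?(ltW e0) //.
  rewrite (lt_le_trans (mid _ _ _ DN Dn (gN N (leqnn N)) (gN n Nn))) //.
  suff -> : 4 * (c * e ^+ 2 / 4) / c = e ^+ 2 by [].
  by field; rewrite gt_eqF.
set x := lim (u @ \oo) in ucvg.
(* Along the sequence [g] tends to [m < a], yet lower semicontinuity would keep it above [a]. For
   [x] outside [D] the second premise is vacuous. *)
have absurd a : m < a -> (D x -> a < g x) -> False.
  move=> ma ax; have ux := gl _ _ ax.
  suff [n [un /lt_trans/(_ un)]] : exists n, a < g (u n) /\ g (u n) < a.
    by rewrite ltxx.
  near \oo => n; exists n; split.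
    by have [Dn _] := uP n; move: Dn; near: n; exact: (ucvg _ ux).
  have [_ un] := uP n; rewrite (lt_trans un) // -ltrBrDl.
  by near: n; apply: invn; rewrite subr_gt0.
have [Dx|nDx] := pselect (D x); last first.
  by case: (absurd (m + 1)) => //; rewrite ltrDl.
exists x => // z Dz; rewrite (le_trans _ (mP _ Dz)) // leNgt; apply/negP => mx.
apply: (absurd ((m + g x) / 2)); last move=> _; lra.
Unshelve. all: by end_near. Qed.

End Minimization.

(** * Resolvents and the Riesz representation *)

Lemma lsc_onD {R : realType} {H : hilbertType R} (D : set H) (g h : H -> R) :
  lsc_on D g -> continuous h -> lsc_on D (fun x => g x + h x).
Proof.
move=> gl hc x a ax.
(* Inside [D] the slack [g x + h x - a] is split evenly between [g] and [h]; outside, [b] can be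
   chosen freely. *)
have [b [e [e0 bx abe]]] : exists b e : R,
    [/\ 0 < e, D x -> b < g x & a <= b + (h x - e)].
  have [Dx|nDx] := pselect (D x); last by exists (a - h x + 1), 1; split => //; lra.
  by have := ax Dx; exists (g x - (g x + h x - a) / 2), ((g x + h x - a) / 2);
    split => [|_|]; lra.
have /cvgrPdist_lt/(_ e e0) := hc x.
apply: filterS2 (gl x b bx) => y gy + Dy; have {}gy := gy Dy.
by rewrite ltr_distlC => /andP[hy _]; lra.
Qed.

Arguments lsc_onD {R H D g h}.

Section Resolvent.
Context {R : realType} {H : hilbertType R}.

Lemma continuous_sqr_norm : continuous (fun z : H => `|z| ^+ 2).
Proof.
move=> z; under [X in continuous_at _ X]eq_fun do rewrite expr2.
by apply: cvgM; exact: norm_continuous.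
Qed.

Lemma continuous_inner (p : H) : continuous (inner p).
Proof.
have pc : continuous (fun z => p + z).
  by move=> z; apply: cvgD; [exact: cvg_cst|exact: cvg_id].
rewrite (_ : inner p = fun z => 2^-1 * (`|p + z| ^+ 2 - `|p| ^+ 2 - `|z| ^+ 2)).
  move=> z; apply: cvgM; first exact: cvg_cst.
  apply: cvgB; last exact: continuous_sqr_norm.
  apply: cvgB; last exact: cvg_cst.
  exact: (continuous_comp (pc z) (continuous_sqr_norm (p + z))).
by apply/funext => z; exact: inner_polarization.
Qed.

(* The point is the minimizer of [z |-> g z + s / 2 * |z|^2 - inner p z]. *)
Lemma resolvent_exists (c s : R) (D : set H) (g : H -> R) (p : H) :
  0 < c -> 0 <= s -> strongly_convex_on c D g -> D !=set0 -> lsc_on D g ->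
  exists x, strong_subgradient c D g x (p - s *: x).
Proof.
move=> c0 s0 gc D0 gl.
pose h z := s / 2 * `|z| ^+ 2 - inner p z.
have ghc : strongly_convex_on c D (fun z => g z + h z).
  move=> x y t Dx Dy t01; have [Dt gt] := gc x y t Dx Dy t01; split => //.
  rewrite /h norm_conv_sqr innerDr !innerZr.
  have : 0 <= s / 2 * (t * (1 - t) * `|x - y| ^+ 2).
    by case/andP: t01 => ? ?; rewrite !mulr_ge0 ?exprn_ge0 // subr_ge0.
  lra.
have hc : continuous h.
  move=> z; apply: cvgB; last exact: continuous_inner.
  by apply: cvgM; [exact: cvg_cst|exact: continuous_sqr_norm].
have [x Dx xmin] := strongly_convex_min c0 ghc D0 (lsc_onD gl hc).
exists x; apply: (strong_subgradient_of_error gc (s := s / 2)) => // z Dz.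
have := xmin z Dz; rewrite /h.
(* Expanding around [x] leaves only the error [s / 2 * |z - x| ^+ 2], which strong convexity
   absorbs. *)
have -> : `|z| ^+ 2 = `|x| ^+ 2 + 2 * inner x (z - x) + `|z - x| ^+ 2.
  by rewrite -normD_sqr addrC subrK.
have -> : inner p z = inner p x + inner p (z - x) by rewrite innerBr addrC subrK.
rewrite innerBl innerZl; lra.
Qed.

Lemma riesz_representation (l : {linear H -> R}) : continuous l ->
  exists z, forall x, l x = inner x z.
Proof.
move=> lc; pose g z := - l z + 2^-1 * `|z| ^+ 2.
have gc : strongly_convex_on 2^-1 setT g.
  move=> x y t _ _ _; split=> //; rewrite /g.
  have -> : l (t *: x + (1 - t) *: y) = t * l x + (1 - t) * l y.
    by rewrite linearD !linearZ.
  rewrite norm_conv_sqr; lra.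
have gl : lsc_on setT g.
  apply: lsc_onD => [x a /(_ I) ax|z].
    by apply: filterS (cvgr_gt _ (continuousN (lc x)) _ ax) => y ay _.
  by apply: cvgM; [exact: cvg_cst|exact: continuous_sqr_norm].
have [||x [_ xP]] := resolvent_exists _ 0 _ _ 0 _ (lexx 0) gc _ gl.
- by rewrite invr_gt0.
- by exists 0.
(* The modulus [2^-1] cancels the quadratic term in [z] exactly, leaving a linear inequality that
   [- z] reverses. *)
have le z : l z <= inner x z.
  have := xP (x + z) I; rewrite (addrC x z) addrK scale0r subr0 linear0l /g.
  rewrite normD_sqr linearD (innerC z x) /=; lra.
exists x => z; rewrite innerC; apply/eqP; rewrite eq_le le /=.
by have := le (- z); rewrite !linearN lerN2.
Qed.

End Resolvent.

Arguments resolvent_exists {R H c} s {D g}.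

(** * The coupled inclusions for real functions on domains *)

Lemma young_sqr {R : realType} (N a b c : R) : 0 < c ->
  - (2^-1 * (N ^+ 2 / (4 * c)) * a ^+ 2) <= 2 * c * b ^+ 2 - N * (a * b).
Proof.
(* Completing the square in [b], with minimizer [N / (4 * c) * a]. *)
move=> c0; have : 0 <= 2 * c * (b - N / (4 * c) * a) ^+ 2.
  by rewrite mulr_ge0 ?sqr_ge0 // mulr_ge0 // ltW.
have -> : 2 * c * (b - N / (4 * c) * a) ^+ 2 =
    2 * c * b ^+ 2 - N * (a * b) + 2^-1 * (N ^+ 2 / (4 * c)) * a ^+ 2.
  by field; rewrite gt_eqF.
lra.
Qed.

Arguments young_sqr {R} N a b {c}.

Lemma subrBACA {M : zmodType} (p q r s : M) : p - q - (r - s) = p - r - (q - s).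
Proof. by rewrite !opprB addrACA [RHS]addrACA (addrC (- q)). Qed.

Section CoupledInclusions.
Context {R : realType} {X Y : hilbertType R}.
Context (A V : {linear X -> Y}) (W : Y -> X) (N KA KV c1 c2 : R).
Context (D1 : set X) (g1 : X -> R) (D2 : set Y) (g2 : Y -> R).
Context (VW : forall x y, inner (V x) y = inner x (W y)).
Context (AVN : forall x, `|A x - V x| <= N * `|x|).
Context (c1_gt0 : 0 < c1) (c2_gt0 : 0 < c2) (Nc : N ^+ 2 < 16 * (c1 * c2)).

(** The strong convexity of [g1] that survives once [young_sqr] has absorbed the mismatch of [A] and
    [V]. As [c1] and [c2] are half moduli, 16 replaces 4 in [Nc]. *)
Lemma margin_gt0 : 0 < 4 * c1 - N ^+ 2 / (4 * c2).
Proof.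
rewrite subr_gt0 ltr_pdivrMr ?mulr_gt0 //.
suff -> : 4 * c1 * (4 * c2) = 16 * (c1 * c2) by [].
ring.
Qed.

(** Write [V = A - (A - V)] and apply Cauchy-Schwarz to the second term. *)
Lemma coupling_lbound x y :
  inner (A x) y - N * (`|x| * `|y|) <= inner (V x) y.
Proof.
rewrite lerBlDl -lerBlDr -innerBl (le_trans (inner_le_norm _ _)) // mulrA.
by rewrite ler_wpM2r.
Qed.

Lemma inner_adjointB x y y' :
  inner x (W y - W y') = inner (V x) (y - y').
Proof. by rewrite !innerBr !VW. Qed.

Lemma coupled_inclusions_unique x y x' y' :
  strong_subgradient c1 D1 g1 x (- W y) ->
  strong_subgradient c2 D2 g2 y (A x) ->
  strong_subgradient c1 D1 g1 x' (- W y') ->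
  strong_subgradient c2 D2 g2 y' (A x') ->
  x = x' /\ y = y'.
Proof.
move=> xW yA x'W y'A.
have yA2 := strong_subgradient_mono yA y'A; rewrite -linearB in yA2.
have := strong_subgradient_mono xW x'W.
have -> : - W y - - W y' = - (W y - W y') by rewrite opprK opprB addrC.
rewrite innerNl innerC inner_adjointB => xW2.
have cl := coupling_lbound (x - x') (y - y').
have yg := young_sqr N `|x - x'| `|y - y'| c2_gt0.
have a0 : (4 * c1 - N ^+ 2 / (4 * c2)) * `|x - x'| ^+ 2 <= 0 by lra.
have {a0}xx : `|x - x'| = 0.
  apply/eqP; rewrite -sqrf_eq0 eq_le exprn_ge0 // andbT.
  by rewrite -(pmulr_rle0 _ margin_gt0).
(* Once [x = x'], the coupling error vanishes, and the sum of the two monotonicity inequalities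
   controls [y] alone. *)
have {}yA2 : 2 * c2 * `|y - y'| ^+ 2 <= 0.
  by move: cl yA2 xW2; rewrite xx; lra.
have yy : `|y - y'| = 0.
  apply/eqP; rewrite -sqrf_eq0 eq_le exprn_ge0 // andbT.
  by rewrite -(pmulr_rle0 _ (mulr_gt0 (ltr0Sn R 1) c2_gt0)).
by split; apply/subr0_eq/normr0_eq0.
Qed.

Context (KA0 : 0 <= KA) (AK : forall x, `|A x| <= KA * `|x|).
Context (KV0 : 0 <= KV) (VK : forall x, `|V x| <= KV * `|x|).
Context (g1c : strongly_convex_on c1 D1 g1) (D1n : D1 !=set0) (g1l : lsc_on D1 g1).
Context (g2c : strongly_convex_on c2 D2 g2) (D2n : D2 !=set0) (g2l : lsc_on D2 g2).

Lemma coupled_inclusions_exist : exists x y,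
  strong_subgradient c1 D1 g1 x (- W y) /\ strong_subgradient c2 D2 g2 y (A x).
Proof.
have /choice[eta etaP] x : exists y, strong_subgradient c2 D2 g2 y (A x).
  have [y] := resolvent_exists 0 (A x) c2_gt0 (lexx 0) g2c D2n g2l.
  by rewrite scale0r subr0; exists y.
have eta_mono x x' : 2 * c2 * `|eta x - eta x'| ^+ 2 <=
    inner (A (x - x')) (eta x - eta x').
  by rewrite (linearB A); exact: strong_subgradient_mono.
(* Cancels one factor [d]; the premise [0 <= b] covers [d = 0]. *)
have norm_le (a b d : R) : 0 <= d -> a * d ^+ 2 <= b * d -> 0 <= b ->
    a * d <= b.
  rewrite le_eqVlt => /predU1P[<- _|d0]; first by rewrite mulr0.
  by rewrite expr2 mulrA ler_pM2r.
pose L := KV * (KA / (2 * c2)).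
have L0 : 0 <= L by rewrite mulr_ge0 // divr_ge0 // mulr_ge0 // ltW.
have eta_lip x x' : `|eta x - eta x'| <= KA / (2 * c2) * `|x - x'|.
  rewrite mulrAC ler_pdivlMr ?mulr_gt0 // mulrC.
  apply: norm_le => //; last by rewrite mulr_ge0.
  rewrite (le_trans (eta_mono x x')) // (le_trans (inner_le_norm _ _)) //.
  by rewrite ler_wpM2r.
(* The difference is paired with itself, which moves [W] onto [V] at the cost of the factor [KV];
   one norm then cancels. *)
have W_lip x x' : `|W (eta x) - W (eta x')| <= L * `|x - x'|.
  rewrite -[leLHS]mul1r; apply: norm_le => //; last by rewrite mulr_ge0.
  rewrite mul1r -inner_normE inner_adjointB (le_trans (inner_le_norm _ _)) //.
  set w := `|W _ - _|.
  rewrite (le_trans (ler_wpM2r (normr_ge0 _) (VK _))) // -/w.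
  rewrite (le_trans (ler_wpM2l _ (eta_lip x x'))) ?mulr_ge0 ?normr_ge0 //.
  by rewrite le_eqVlt /L; apply/orP; left; apply/eqP; ring.
(* With this [s], the Lipschitz constant of [T] is
   sqrt (s ^ 2 + 4 c1 s) / (2 c1 + s) < 1. *)
pose m := 4 * c1 - N ^+ 2 / (4 * c2).
have m0 : 0 < m by exact: margin_gt0.
pose s := L ^+ 2 / m.
have s0 : 0 <= s by rewrite divr_ge0 // ?exprn_ge0 // ltW.
have sm : s * m = L ^+ 2 by rewrite /s divfK // gt_eqF.
have /choice[T TP] x : exists z,
    strong_subgradient c1 D1 g1 z (s *: x - W (eta x) - s *: z).
  exact: resolvent_exists _ _ c1_gt0 s0 g1c D1n g1l.
have d0 : 0 < 2 * c1 + s by rewrite ltr_pwDl // mulr_gt0.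
have T_lip x x' : (2 * c1 + s) ^+ 2 * `|T x - T x'| ^+ 2 <=
    (s ^+ 2 + 4 * c1 * s) * `|x - x'| ^+ 2.
  (* [v] is the difference of the inputs of the resolvent, whose inverse is strongly monotone with
     constant [2 * c1 + s]. *)
  pose v := s *: (x - x') - (W (eta x) - W (eta x')).
  have vT : (2 * c1 + s) * `|T x - T x'| <= `|v|.
    apply: norm_le => //; rewrite (le_trans _ (inner_le_norm _ _)) //.
    rewrite mulrDl -lerBrDr (le_trans (strong_subgradient_mono (TP x) (TP x'))) //.
    rewrite -inner_normE -innerZl -innerBl.
    suff -> : s *: x - W (eta x) - s *: T x - (s *: x' - W (eta x') - s *: T x')
      = v - s *: (T x - T x') by [].
    by rewrite /v !scalerBr subrBACA (subrBACA (s *: x)).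
  rewrite -exprMn.
  (* Per unit of [|x - x'| ^+ 2], the cross term costs at most [s * (N ^+ 2 / (4 * c2))] and the
     last square [L ^+ 2 = s * m]; the two sum to exactly [4 * c1 * s]. *)
  have v2 : `|v| ^+ 2 <= (s ^+ 2 + 4 * c1 * s) * `|x - x'| ^+ 2.
    rewrite /v normB_sqr normZ_sqr innerZl inner_adjointB.
    have cl := coupling_lbound (x - x') (eta x - eta x').
    have em := eta_mono x x'.
    have wl : `|W (eta x) - W (eta x')| ^+ 2 <= L ^+ 2 * `|x - x'| ^+ 2.
      by rewrite -exprMn ler_pXn2r ?nnegrE ?(mulr_ge0 L0) ?normr_ge0 //.
    set a := `|x - x'| in cl wl *; set b := `|eta x - eta x'| in cl em.
    have lb : - (2^-1 * (N ^+ 2 / (4 * c2)) * a ^+ 2) <=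
        inner (V (x - x')) (eta x - eta x').
      by have := young_sqr N a b c2_gt0; lra.
    have := ler_wpM2l s0 lb.
    have := congr1 (fun r => r * a ^+ 2) sm; rewrite /m /=; lra.
  apply: le_trans v2.
  by rewrite ler_pXn2r ?nnegrE ?(mulr_ge0 (ltW d0)) ?normr_ge0.
have n0 : 0 <= s ^+ 2 + 4 * c1 * s.
  by rewrite addr_ge0 ?exprn_ge0 ?(mulr_ge0 _ s0) ?(mulr_ge0 _ (ltW c1_gt0)).
pose q := Num.sqrt (s ^+ 2 + 4 * c1 * s) / (2 * c1 + s).
have q0 : 0 <= q by rewrite divr_ge0 ?sqrtr_ge0 // ltW.
have q2 : q ^+ 2 = (s ^+ 2 + 4 * c1 * s) / (2 * c1 + s) ^+ 2.
  by rewrite expr_div_n sqr_sqrtr.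
have q1 : q < 1.
  rewrite -(ltr_pXn2r (ltn0Sn 1)) ?nnegrE // q2 expr1n.
  rewrite ltr_pdivrMr ?exprn_gt0 // mul1r.
  have : 0 < c1 ^+ 2 by rewrite exprn_gt0.
  lra.
have [|||x _ fx] := @banach_fixed_point R X setT (totalfun_ setT T).
- exists (NngNum q0); split => //= -[x x'] _ /=; rewrite /totalfun_.
  rewrite -(ler_pXn2r (ltn0Sn 1)) ?nnegrE ?(mulr_ge0 q0) ?normr_ge0 // exprMn q2.
  by rewrite mulrAC ler_pdivlMr ?exprn_gt0 // mulrC.
- exact: closedT.
- by exists 0.
exists x, (eta x); split; last exact: etaP.
have := TP x; rewrite -[T x]fx.
by rewrite addrAC subrr add0r.
Qed.

End CoupledInclusions.

Arguments coupled_inclusions_unique {R X Y A V W N c1 c2 D1 g1 D2 g2}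
  VW AVN c2_gt0 Nc {x y x' y'}.
Arguments coupled_inclusions_exist {R X Y A V W N KA KV c1 c2 D1 g1 D2 g2}.

(** * From extended real functions to real ones on domains *)

Section ExtendedReal.
Context {R : realType} {H : hilbertType R} {f : H -> \bar R} {gamma : R}.
Context (pf : eproper f) (cf : strongly_convex gamma f).

Let D : set H := [set x | (f x < +oo)%E].
(** At [+oo] the value of [fine] is 0; the conditions on [g] test it on [D] only. *)
Let g x := fine (f x).

Lemma eproper_fineE x : D x -> f x = (fine (f x))%:E.
Proof.
by move=> Dx; rewrite fineK // fin_numE gt_eqF ?(pf.1 x)//= lt_eqF.
Qed.

Lemma strongly_convex_fine : strongly_convex_on (gamma / 2) D g.
Proof.
move=> x y t Dx Dy t01; have := cf x y t t01.
rewrite /= (eproper_fineE _ Dx) (eproper_fineE _ Dy) -!EFinB -!EFinM -EFinD.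
set z := t *: x + _ => fz.
have Dz : D z.
  have := le_lt_trans fz (ltry _); rewrite /D /=.
  by case: (f z) => [r _||//]; rewrite ?ltry.
move: fz; split => //; move: fz.
by rewrite (eproper_fineE _ Dz) lee_fin norm_conv_sqr /g; lra.
Qed.

Lemma lsc_fine : lower_semicontinuous f -> lsc_on D g.
Proof.
move=> lf x a ax; have [|U xU Ua] := lf x a.
  have [Dx|/negP] := pselect (D x).
    by rewrite (eproper_fineE _ Dx) lte_fin; exact: ax.
  by rewrite -leNgt leye_eq => /eqP ->; exact: ltry.
by apply: filterS xU => y /Ua + Dy; rewrite (eproper_fineE _ Dy) lte_fin.
Qed.

(** Properness forces [x] into [D] and strong convexity sharpens the subgradient inequality;
    conversely the quadratic term is dropped, and points outside [D] are trivial. *)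
Lemma subdiffE (gamma0 : 0 < gamma) x q :
  subdiff f x q <-> strong_subgradient (gamma / 2) D g x q.
Proof.
split=> [fq|[Dx gq] z].
  have Dx : D x.
    have [z fz] := pf.2; have := le_lt_trans (fq z) fz; rewrite /D /=.
    by case: (f x) => [r _||//]; rewrite ?ltry.
  apply: (strong_subgradient_of_error strongly_convex_fine (s := 0)) => // z Dz.
  have := fq z; rewrite (eproper_fineE _ Dx) (eproper_fineE _ Dz) lee_fin /g; lra.
have [Dz|/negP] := pselect (D z); last first.
  by rewrite -leNgt leye_eq => /eqP ->; exact: leey.
have := gq z Dz; rewrite (eproper_fineE _ Dx) (eproper_fineE _ Dz) lee_fin /g.
by apply: le_trans; rewrite lerDl mulr_ge0 ?exprn_ge0 // divr_ge0 // ltW.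
Qed.

End ExtendedReal.

(** * Operator norm and adjoint *)

Section BoundedOperators.
Context {R : realType} {X Y : hilbertType R}.

Lemma linear_bound (T : {linear X -> Y}) : bounded_near T (nbhs (0 : X)) ->
  exists2 K, 0 <= K & forall x, `|T x| <= K * `|x|.
Proof.
move=> /linear_boundedP Tb.
have [K [KT K0]] := filter_ex (filterI Tb (nbhs_pinfty_ge (num_real 0))).
by exists K.
Qed.

Lemma op_norm_le (T : {linear X -> Y}) (K : R) :
  (forall x, `|T x| <= K * `|x|) ->
  forall x, `|T x| <= op_norm T * `|x|.
Proof.
(* Without an upper bound [sup] would take a default value; [K] supplies one. *)
move=> TK x; have ub : has_ubound [set `|T x| | x in [set x : X | `|x| <= 1]].
  exists `|K| => _ [z /= z1 <-]; rewrite (le_trans (TK z)) //.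
  rewrite (le_trans (ler_wpM2r _ (ler_norm K))) //.
  by rewrite -[leRHS]mulr1 ler_wpM2l.
have [->|x0] := eqVneq x 0; first by rewrite linear0 !normr0 mulr0.
have nx : 0 < `|x| by rewrite normr_gt0.
rewrite -ler_pdivrMr //; apply: (ub_le_sup ub); exists (`|x|^-1 *: x).
  by rewrite /= normrZ normfV normr_id mulVf // gt_eqF.
by rewrite linearZ normrZ normfV normr_id mulrC.
Qed.

Lemma adjointP (T : {linear X -> Y}) (K : R) :
  (forall x, `|T x| <= K * `|x|) ->
  forall x y, inner (T x) y = inner x (adjoint T y).
Proof.
move=> TK x y; rewrite /adjoint.
(* Riesz representation of [x |-> inner (T x) y] rules out the default value 0 of [xget]. *)
case: xgetP => [z _ -> //|/(_ _)] noz; exfalso.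
have lT : continuous T.
  apply/linear_bounded_continuous/linear_boundedP.
  apply: filterS (nbhs_pinfty_ge (num_real K)) => r Kr z.
  by rewrite (le_trans (TK z)) // ler_wpM2r.
have [|z zP] := @riesz_representation _ _ (applyr inner y \o T : {linear X -> R}).
  move=> z; apply: continuous_comp; first exact: lT.
  rewrite /= (_ : applyr inner y = inner y); first exact: continuous_inner.
  by apply/funext => w; rewrite innerC.
exact: (noz z).
Qed.

End BoundedOperators.

Theorem theorem2p3 (R : realType) (X Y : hilbertType R)
    (A V : {linear X -> Y})
    (bA : bounded_near A (nbhs (0 : X))) (bV : bounded_near V (nbhs (0 : X)))
    (G : X -> \bar R) (Fstar : Y -> \bar R) (gammaG gammaF : R)
    (pG : eproper G) (lG : lower_semicontinuous G)
    (pF : eproper Fstar) (lF : lower_semicontinuous Fstar)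
    (gammaG_gt0 : 0 < gammaG) (gammaF_gt0 : 0 < gammaF)
    (scG : strongly_convex gammaG G) (scF : strongly_convex gammaF Fstar)
    (gammaGF : 4^-1 * op_norm (fun x => A x - V x) ^+ 2 < gammaG * gammaF) :
  exists! u : X * Y,
    [set p + adjoint V u.2 | p in subdiff G u.1] 0 /\
    [set q - A u.1 | q in subdiff Fstar u.2] 0.
Proof.
have [KA KA0 AK] := linear_bound _ bA; have [KV KV0 VK] := linear_bound _ bV.
have VW := adjointP _ _ VK.
have AVN : forall x, `|A x - V x| <= op_norm (fun x => A x - V x) * `|x|.
  apply: (op_norm_le (A \- V) (KA + KV)) => x /=.
  by rewrite mulrDl (le_trans (ler_normB _ _)) // lerD.
have c1 : 0 < gammaG / 2 by rewrite divr_gt0.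
have c2 : 0 < gammaF / 2 by rewrite divr_gt0.
have Nc : op_norm (fun x => A x - V x) ^+ 2 < 16 * (gammaG / 2 * (gammaF / 2)).
  suff -> : 16 * (gammaG / 2 * (gammaF / 2)) = 4 * (gammaG * gammaF).
    by rewrite -ltr_pdivrMl.
  by field.
have inclE x y : ([set p + adjoint V y | p in subdiff G x] 0 /\
    [set q - A x | q in subdiff Fstar y] 0) <->
    (subdiff G x (- adjoint V y) /\ subdiff Fstar y (A x)).
  split=> [[[p Gp /eqP]]|[Gp Fq]].
    rewrite addr_eq0 => /eqP pV [q Fq /eqP]; rewrite subr_eq0 => /eqP qA.
    by rewrite -pV -qA.
  split; first by exists (- adjoint V y) => //; rewrite addNr.
  by exists (A x) => //; rewrite subrr.
have [x [y xy]] := coupled_inclusions_exist VW AVN c1 c2 Nc KA0 AK KV0 VK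
  (strongly_convex_fine pG scG) pG.2 (lsc_fine pG lG)
  (strongly_convex_fine pF scF) pF.2 (lsc_fine pF lF).
exists (x, y); split=> [|[x' y'] /= /inclE[]].
  apply/inclE; case: xy => xG yF.
  by split; [exact/(subdiffE pG scG)|exact/(subdiffE pF scF)].
move=> /(subdiffE pG scG gammaG_gt0) Gx /(subdiffE pF scF gammaF_gt0) Fy.
by have [-> ->] := coupled_inclusions_unique VW AVN c2 Nc xy.1 xy.2 Gx Fy.
Qed.
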